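(* Let $\mathcal{D}$ be a PDF-bounded distribution on $[0,1]$, and let $C\ge 1$ be an arbitrary constant. Consider $n$ agents and $m$ items, with each utility $u_i(g)$ drawn independently from $\mathcal{D}$. For any weight vector $(w_1,\ldots,w_n)$ of positive reals with $w_{\max}/w_{\min}\le C$, if $m=\Omega(n\log n/\log\log n)$, then the allocation produced by the weighted picking sequence algorithm is weighted envy-free (WEF) with high probability, i.e., with probability tending to $1$ as $n\to\infty$.
   Context: Agents $N=[n]$ with positive weights $w_i$; items $M=[m]$. Each agent $i$ has an additive utility $u_i(S)=\sum_{g\in S}u_i(g)$; each $u_i(g)$ is drawn independently from a distribution $\mathcal{D}$ over $[0,1]$. $w_{\max},w_{\min}$ denote the maximum and minimum weights. A distribution $\mathcal{D}$ is $(\alpha,\beta)$-PDF-bounded if it is non-atomic and its density $f_{\mathcal{D}}$ satisfies $\alpha\le f_{\mathcal{D}}(x)\le\beta$ for all $x\in[0,1]$; it is PDF-bounded if this holds for some constants $\alpha,\beta>0$. An allocation $(A_1,\ldots,A_n)$ (a partition of $M$) is WEF if $u_i(A_i)/w_i\ge u_i(A_j)/w_j$ for all $i,j\in N$. The weighted picking sequence algorithm: start with $A_i=\emptyset$, $t_i=0$ for all $i$; while items remain, pick an agent $i^*$ minimizing $t_i/w_i$ (ties broken arbitrarily), let $i^*$ take an item of maximum utility to her among the remaining items, and increase $t_{i^*}$ by $1$. *)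

(* Defs.v *)
From HB Require Import structures.
From mathcomp Require Import all_boot all_order all_algebra.
From mathcomp Require Import all_classical all_reals all_analysis.
Set Implicit Arguments. Unset Strict Implicit. Unset Printing Implicit Defensive.
Import Order.TTheory GRing.Theory Num.Theory.
Local Open Scope classical_set_scope.
Local Open Scope ring_scope.

Section PickingSequence.
Variables (R : realType) (n m : nat).

(** Number of picks made by agent [i] at steps [0 .. k-1] of the picking
    order [s] (step k is performed by agent [s k]). *)
Definition picks_before (s : 'I_m -> 'I_n) (k : nat) (i : 'I_n) : nat :=
  #|[set k' : 'I_m | (k' < k)%N && (s k' == i)]|.

(** [s] is a valid order of turns for the weighted picking sequence algorithm:
    at every step, the agent who picks minimizes t_i / w_i, where t_i is the
    number of items picked so far by i (ties broken arbitrarily). *)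
Definition valid_wps (w : 'I_n -> R) (s : 'I_m -> 'I_n) : Prop :=
  forall (k : 'I_m) (j : 'I_n),
    (picks_before s k (s k))%:R / w (s k) <= (picks_before s k j)%:R / w j.

(** Run of the algorithm for [k] steps: the list of (agent, item) picks.
    At each step the agent takes an item of maximum utility to her among the
    remaining items (a fixed rule resolves ties among items). *)
Fixpoint wps_run (u : 'I_n -> 'I_m -> R) (s : 'I_m -> 'I_n) (k : nat)
  : seq ('I_n * 'I_m) :=
  match k with
  | 0 => [::]
  | k'.+1 =>
    let T := wps_run u s k' in
    match insub k' with
    | Some kk =>
      let i := s kk in
      match [pick g | g \notin unzip2 T] with
      | Some g0 => rcons T (i, [arg max_(g > g0 | g \notin unzip2 T) u i g]%O)
      | None => T
      end
    | None => T
    end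
  end.

Definition wps_alloc (u : 'I_n -> 'I_m -> R) (s : 'I_m -> 'I_n) (i : 'I_n)
  : {set 'I_m} :=
  [set g | (i, g) \in wps_run u s m].

Definition util (u : 'I_n -> 'I_m -> R) (i : 'I_n) (S : {set 'I_m}) : R :=
  \sum_(g in S) u i g.

Definition WEF (w : 'I_n -> R) (u : 'I_n -> 'I_m -> R)
  (A : 'I_n -> {set 'I_m}) : Prop :=
  forall i j : 'I_n, util u i (A j) / w j <= util u i (A i) / w i.

End PickingSequence.

Definition pdf_bounded_ab (R : realType) (D : probability (measurableTypeR R) R)
  (alpha beta : R) : Prop :=
  (forall x : R, D [set x] = 0%E) /\
  exists f : R -> R,
    measurable_fun (`[0%R, 1%R] : set R) f /\
    (forall x : R, 0 <= x <= 1 -> alpha <= f x <= beta) /\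
    (forall A : set R, measurable A ->
       D A = (\int[@lebesgue_measure R]_(x in A `&` (`[0%R, 1%R] : set R)) (f x)%:E)%E).

Definition pdf_bounded (R : realType) (D : probability (measurableTypeR R) R)
  : Prop :=
  exists alpha beta : R, 0 < alpha /\ 0 < beta /\ pdf_bounded_ab D alpha beta.

Definition iid_with (R : realType) (d : measure_display) (Omega : measurableType d)
  (P : probability Omega R) (n m : nat) (U : 'I_n -> 'I_m -> Omega -> R)
  (D : probability (measurableTypeR R) R) : Prop :=
  (forall i g, measurable_fun setT (U i g)) /\
  (forall i g (A : set R), measurable A -> P (U i g @^-1` A) = D A) /\
  (forall B : 'I_n -> 'I_m -> set R, (forall i g, measurable (B i g)) ->
     fine (P [set om | forall i g, B i g (U i g om)]) =
     \prod_(i < n) \prod_(g < m) fine (P (U i g @^-1` B i g))).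

(* Main.v *)
(** Cut [0,1] into L cells of mass 1/L under D, so that utilities become
    uniform values in {0, ..., L-1}, without ties once L is large.

    Fix agents i <> j. Each pick of j but the first is made after a pick that i
    valued at least as much, and charging it to the preceding pick of i shows
    that i is free of envy as soon as the gains (value to i of her preceding
    pick minus value to i of j's pick) add up to the value of j's first pick,
    which is at most 1.

    Reveal the values of i along the run: given that the r remaining items are
    worth less than v to i, a pick of i costs a factor
    r * (sum of z^(r-1) over z < v) <= v^r, and the value to i of an item picked
    by j is uniform below v. So the number of rows of i for which l picks of j
    gain at most c in total is at most L^m (16/L)^l C(c,l), provided v >= L/16
    at these picks; for c of order L this is a fraction O(1)^l / l!, which is
    smaller than n^-3 for l of order log n / log log n. The cap v stays above
    L/16 during the first half of the run, since otherwise at least half of the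
    items would be worth less than L/16 to i, which has probability at most
    2^-m. *)
Require Import Defs.
From mathcomp Require Import all_boot all_order all_algebra zify ring lra.
From mathcomp Require Import all_classical all_reals all_analysis.
From mathcomp Require Import measurable_realfun.
Set Implicit Arguments. Unset Strict Implicit. Unset Printing Implicit Defensive.
Import Order.TTheory GRing.Theory Num.Theory.
Import numFieldNormedType.Exports.

(** * Binomial and power-sum estimates *)

(** Hockey-stick summation over the gain [v - y] of one counted pick. The factor [v <= c + y] drops
    gains above the budget, for which truncated subtraction would give ['C(0, 0) = 1] when
    [l = 0]. *)
Lemma sum_bin_below (c l v : nat) :
  \sum_(y < v) (v <= c + y) * 'C(c - (v - y), l) + 'C(c - v, l.+1) = 'C(c, l.+1).
Proof.
elim: v => [|v IH]; first by rewrite big_ord0 subn0.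
rewrite big_ord_recl /= addn0 subn0 -{}IH.
under eq_bigr do rewrite /bump /= add1n addnS ltnS subSS.
rewrite addnAC addnC; set X := (\sum_(_ < _) _)%N.
suff -> : (v < c) * 'C(c - v.+1, l) + 'C(c - v.+1, l.+1) = 'C(c - v, l.+1) by [].
have [vc|cv] := ltnP v c; first by rewrite mul1n -(subnSK vc) binS addnC.
have [-> ->] : c - v.+1 = 0 /\ c - v = 0 by lia.
by rewrite mul0n bin0n.
Qed.

Lemma expnS_ge_deriv (v r : nat) : v ^ r + r * v ^ r.-1 <= v.+1 ^ r.
Proof.
elim: r => [|r IH] //=; rewrite !expnS.
apply: leq_trans (leq_mul (leqnn v.+1) IH).
have : r * (v * v ^ r.-1) = r * v ^ r by case: r {IH} => //= r; rewrite expnS.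
by move: (v ^ r) (v ^ r.-1) => X Y; rewrite !mulSn mulnDr; lia.
Qed.

(** The increments of [z ^ r] telescope, and each dominates the derivative by the first two terms of
    the binomial expansion. *)
Lemma sum_expn_le (v r : nat) : r * (\sum_(z < v) z ^ r.-1) <= v ^ r.
Proof.
elim: v => [|v IH]; first by rewrite big_ord0 muln0.
rewrite big_ord_recr /= mulnDr; apply: leq_trans (expnS_ge_deriv v r).
by rewrite leq_add2r.
Qed.

(** Serves at two levels: fixing the value of one item in a row, and replacing the row of one agent
    in a matrix. *)
Definition upd (I : finType) (T : Type) (f : {ffun I -> T}) (i : I) (y : T) :
  {ffun I -> T} := [ffun j => if j == i then y else f j].

(** * Counting the rows of one agent by revealing values along the run *)

Section Counting.
Variables (I : finType) (L b : nat).
Implicit Types (S : {set I}) (x : {ffun I -> 'I_L}).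

(** Once the rows of the other agents are fixed, what they take depends only on the set of remaining
    items. Hence a turn carries a choice function rather than an item. *)
Inductive turn := Me | Other of ({set I} -> I) | Counted of ({set I} -> I).

Definition is_counted (t : turn) := if t is Counted _ then true else false.

(* The items in [S] remain, and all of them are worth less than the cap [v],
   the value of the agent's previous pick, to the agent with values [x]; the
   budget [c] bounds the total amount by which counted picks fall below the
   cap. *)
Fixpoint low_gain (ts : seq turn) S (v c : nat) x : bool :=
  match ts with
  | [::] => true
  | Me :: ts' => [exists g in S, [forall h in S :\ g, x h < x g]
                                 && low_gain ts' (S :\ g) (x g) c x]
  | Other o :: ts' => (o S \in S) && low_gain ts' (S :\ o S) v c x
  | Counted o :: ts' =>
      [&& o S \in S, L <= b * v, v <= c + x (o S)
        & low_gain ts' (S :\ o S) v (c - (v - x (o S))) x]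
  end.

(** The state of knowledge midway through the run: items already taken have known values, recorded
    in [x0]; the others are known only to lie below the cap. *)
Definition slice S (v : nat) x0 : pred {ffun I -> 'I_L} :=
  fun x => [forall g, if g \in S then x g < v else x g == x0 g].

Lemma sum_ord_lt_le (v : nat) (F : nat -> nat) :
  \sum_(y < L | y < v) F y <= \sum_(y < v) F y.
Proof.
rewrite -(big_mkord (fun y => y < v) F) -(big_mkord xpredT F).
have [Lv|vL] := leqP L v.
  rewrite (big_nat_widen _ _ v) //= !big_mkord [X in _ <= X](bigID (fun y : 'I_v => y < L)) /=.
  apply: leq_trans (leq_addr _ _); apply: eq_leq; apply: eq_bigl => y.
  by rewrite ltn_ord.
by rewrite [X in _ <= X](big_nat_widen _ _ L) //= ltnW.
Qed.

Lemma card_slice S v x0 : #|slice S v x0| <= v ^ #|S|.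
Proof.
pose F (g : I) : pred 'I_L := fun y => if g \in S then y < v else y == x0 g.
have -> : #|slice S v x0| = #|family F| by apply: eq_card.
rewrite card_family foldrE big_map big_enum /=.
rewrite (bigID [in S]) /= -[X in _ <= X]muln1 leq_mul //.
  rewrite -prod_nat_const; apply: leq_prod => g gS.
  rewrite (eq_card (B := [pred y : 'I_L | y < v])); last first.
    by move=> y; rewrite /in_mem /= /F gS.
  rewrite -sum1_card; apply: leq_trans (sum_ord_lt_le v (fun=> 1)) _.
  by rewrite sum_nat_const card_ord muln1.
rewrite big1 // => g gS; rewrite (eq_card (B := pred1 (x0 g))) ?card1 //.
by move=> y; rewrite /in_mem /= /F (negbTE gS).
Qed.

(** Reveals the value [y] of the item [g] taken next. The new cap [v' y] is [y] after a pick of the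
    agent herself and stays [v] after a pick of someone else. *)
Lemma card_slice_branch S v x0 (g : I) (E : pred {ffun I -> 'I_L})
    (v' : 'I_L -> nat) (E' : 'I_L -> pred {ffun I -> 'I_L}) :
    g \in S ->
    (forall x, slice S v x0 x -> E x ->
       (forall h, h \in S :\ g -> x h < v' (x g)) /\ E' (x g) x) ->
  #|[pred x | slice S v x0 x & E x]| <=
  \sum_(y < L | y < v)
     #|[pred x | slice (S :\ g) (v' y) (upd x0 g y) x & E' y x]|.
Proof.
move=> gS HE.
have -> : #|[pred x | slice S v x0 x & E x]| =
    \sum_(y < L | y < v) #|[pred x | slice S v x0 x & E x && (x g == y)]|.
  rewrite -sum1_card (partition_big (fun x => x g) (fun y : 'I_L => y < v)) /=.
    apply: eq_bigr => y _; rewrite -sum1_card; apply: eq_bigl => x.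
    by rewrite !inE andbA.
  by move=> x /andP[/forallP/(_ g)]; rewrite gS.
apply: leq_sum => y _; apply/subset_leq_card/fintype.subsetP => x.
rewrite !inE => /and3P[xS Ex /eqP xg].
have [lt_x E'x] := HE x xS Ex; rewrite xg in lt_x E'x.
rewrite E'x andbT; apply/forallP => h; rewrite /upd ffunE.
have [hS|] := boolP (h \in S :\ g); first exact: lt_x.
rewrite !inE negb_and negbK; case: eqP => [->|_ /= hS]; first by rewrite xg.
by move: xS => /forallP/(_ h); rewrite (negbTE hS).
Qed.

(** Induction on the turns: [sum_expn_le] pays for the agent's own picks, a factor [v] for each pick
    of the others, and [sum_bin_below] for the budget spent at counted picks. *)
Lemma card_low_gain ts S v c x0 (l := count is_counted ts) :
  L ^ l * #|[pred x | slice S v x0 x & low_gain ts S v c x]| <=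
  v ^ #|S| * (b ^ l * 'C(c, l)).
Proof.
rewrite {}/l; elim: ts S v c x0 => [|t ts IH] S v c x0.
  rewrite /= bin0 !expn0 mul1n !muln1; apply: leq_trans (card_slice S v x0).
  by apply/subset_leq_card/fintype.subsetP => x; rewrite !inE => /andP[].
have cardD g : g \in S -> #|S| = #|S :\ g|.+1 by move=> gS; rewrite (cardsD1 g) gS.
case: t => [|o|o] /=.
- rewrite add0n; set l := count _ _.
  (* Union bound over the item [g] that the agent takes, whose value [y] becomes the cap. *)
  apply: (@leq_trans (L ^ l * \sum_(g in S) \sum_(y < L | y < v)
     #|[pred x | slice (S :\ g) y (upd x0 g y) x & low_gain ts (S :\ g) y c x]|)).
    rewrite leq_mul2l; apply/orP; right.
    pose E g : pred {ffun I -> 'I_L} := fun x =>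
      [forall h in S :\ g, x h < x g] && low_gain ts (S :\ g) (x g) c x.
    apply: (@leq_trans (\sum_(g in S) #|[pred x | slice S v x0 x & E g x]|)).
      rewrite -!sum1_card.
      under [X in _ <= X]eq_bigr do rewrite -sum1_card.
      rewrite (exchange_big_dep [pred x | slice S v x0 x]) /=; last first.
        by move=> g x _; rewrite inE => /andP[].
      rewrite [X in _ <= X](bigID (fun x => [exists g in S, E g x])) /=.
      apply: leq_trans (leq_addr _ _); apply: leq_sum => x.
      move=> /andP[xs /existsP[g /andP[gS Eg]]].
      by rewrite (bigD1 g) //= gS inE xs /E Eg.
    apply: leq_sum => g gS.
    apply: (card_slice_branch (v' := fun y => y) (E' := fun y => low_gain ts (S :\ g) y c)) => //.
    by move=> x xs /andP[/forall_inP lt_x]; split.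
  rewrite big_distrr /=.
  apply: (@leq_trans (\sum_(g in S) \sum_(y < v) (y ^ #|S|.-1 * (b ^ l * 'C(c, l))))).
    apply: leq_sum => g gS; rewrite big_distrr /=.
    apply: leq_trans (sum_ord_lt_le v (fun y => y ^ #|S|.-1 * (b ^ l * 'C(c, l)))).
    apply: leq_sum => y _; apply: leq_trans (IH _ _ _ _) _.
    by rewrite (cardD _ gS).
  by rewrite sum_nat_const -big_distrl /= mulnA leq_mul // sum_expn_le.
- rewrite add0n; set l := count _ _.
  have [oS|oS] := boolP (o S \in S); last by rewrite [X in _ * X <= _]eq_card0 ?muln0 // => x; rewrite !inE ?andbF.
  apply: (@leq_trans (L ^ l * \sum_(y < L | y < v)
     #|[pred x | slice (S :\ o S) v (upd x0 (o S) y) x & low_gain ts (S :\ o S) v c x]|)).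
    rewrite leq_mul2l; apply/orP; right.
    apply: (card_slice_branch (v' := fun y => v) (E' := fun y => low_gain ts (S :\ o S) v c)) => //.
    move=> x xs /= lg; split=> // h; rewrite !inE => /andP[_ hS].
    by move: xs => /forallP/(_ h); rewrite hS.
  rewrite big_distrr /=.
  apply: (@leq_trans (\sum_(y < L | y < v) (v ^ #|S|.-1 * (b ^ l * 'C(c, l))))).
    apply: leq_sum => y _; apply: leq_trans (IH _ _ _ _) _.
    by rewrite (cardD _ oS).
  apply: leq_trans (sum_ord_lt_le v (fun _ => v ^ #|S|.-1 * (b ^ l * 'C(c, l)))) _.
  by rewrite sum_nat_const card_ord mulnA -expnS prednK // (cardD _ oS).
- rewrite add1n; set l := count _ _.
  have [oS|oS] := boolP (o S \in S); last by rewrite [X in _ * X <= _]eq_card0 ?muln0 // => x; rewrite !inE ?andbF.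
  have [Lv|Lv] := boolP (L <= b * v); last by rewrite [X in _ * X <= _]eq_card0 ?muln0 // => x; rewrite !inE ?andbF.
  apply: (@leq_trans (L ^ l.+1 * \sum_(y < L | y < v)
     #|[pred x | slice (S :\ o S) v (upd x0 (o S) y) x &
          (v <= c + y) && low_gain ts (S :\ o S) v (c - (v - y)) x]|)).
    rewrite leq_mul2l; apply/orP; right.
    apply: (card_slice_branch (v' := fun y => v)
      (E' := fun y x => (v <= c + y) && low_gain ts (S :\ o S) v (c - (v - y)) x)) => //.
    move=> x xs /= lg; split=> // h; rewrite !inE => /andP[_ hS].
    by move: xs => /forallP/(_ h); rewrite hS.
  rewrite expnS -mulnA big_distrr /=.
  pose G y := (v <= c + y) * 'C(c - (v - y), l).
  apply: (@leq_trans (L * \sum_(y < L | y < v) (v ^ #|S|.-1 * b ^ l * G y))).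
    rewrite leq_mul2l; apply/orP; right; apply: leq_sum => y _.
    rewrite /G; case: (v <= c + y) => /=; last first.
      by rewrite [X in _ * X <= _]eq_card0 ?muln0 // => x; rewrite !inE andbF.
    rewrite mul1n; apply: leq_trans (IH _ _ _ _) _.
    by rewrite (cardD _ oS) mulnA.
  rewrite -big_distrr /=.
  have HG : \sum_(y < L | y < v) G y <= 'C(c, l.+1).
    apply: leq_trans (sum_ord_lt_le v G) _.
    by rewrite -(sum_bin_below c l v) leq_addr.
  have -> : v ^ #|S| = v * v ^ #|S|.-1 by rewrite -expnS prednK // (cardD _ oS).
  apply: leq_trans (leq_mul (leqnn L) (leq_mul (leqnn _) HG)) _.
  rewrite expnS mulnA [v * _]mulnC; move: (v ^ _) (b ^ l) 'C(c, _) => A B H.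
  (* The factor [L] owed to this counted pick is traded for [b * v], by the lower bound [Lv] on the
     cap. *)
  by rewrite (_ : A * v * (b * B * H) = b * v * (A * B) * H) ?leq_mul //; lia.
Qed.
End Counting.

(** * Averaging over the other rows, and two rare events of a single row *)

Lemma sum_card_upd (I X : finType) (E : pred {ffun I -> X}) (i : I) :
  \sum_(v : {ffun I -> X}) #|[pred x | E (upd v i x)]| = #|X| * #|E|.
Proof.
under eq_bigr do rewrite -sum1_card big_mkcond /=.
rewrite pair_big /=.
(* Exchanging coordinate [i] with the spare value is an involution on pairs; afterwards the event
   concerns the first component alone and the spare value is free. *)
pose h (p : {ffun I -> X} * X) := (upd p.1 i p.2, p.1 i).
have hK : involutive h.
  case=> v x; rewrite /h /= ffunE eqxx; congr pair.
  by apply/ffunP => j; rewrite !ffunE; case: eqP => [->|].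
rewrite (reindex_inj (inv_inj hK)) /=.
rewrite -(pair_big xpredT xpredT (fun v x => if upd (upd v i x) i (v i) \in E then 1 else 0)) /=.
rewrite (eq_bigr (fun v => #|X| * (v \in E))).
  by rewrite -big_distrr /= -(sum1_card E) [in RHS]big_mkcond.
move=> v _; rewrite (eq_bigr (fun=> (v \in E) : nat)).
  by rewrite sum_nat_const.
move=> x _; have -> : upd (upd v i x) i (v i) = v.
  by apply/ffunP => j; rewrite !ffunE; case: eqP => [->|].
by case: ifP.
Qed.

(** Discrete Fubini: a bound conditional on the other coordinates is averaged over them. *)
Lemma card_upd_le (I X : finType) (E : pred {ffun I -> X}) (i : I) (a b : nat) :
    (forall v, a * #|[pred x | E (upd v i x)]| <= b * #|X|) ->
  a * #|E| <= b * #|{ffun I -> X}|.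
Proof.
move=> H; have [X0|X0] := posnP #|X|.
  rewrite [#|E|]eq_card0 ?muln0 // => v.
  by have := fintype0 (v i) X0.
rewrite -(leq_pmul2l X0) mulnCA -(sum_card_upd E i) big_distrr /=.
apply: (@leq_trans (\sum_(v : {ffun I -> X}) b * #|X|)).
  by apply: leq_sum => v _; exact: H.
by rewrite sum_nat_const mulnA [X in _ <= X]mulnA mulnC [X in _ <= X]mulnC mulnCA mulnC -mulnA.
Qed.

(** Markov's inequality for 16 raised to the number of small values: its mean per item is at most 2,
    while the rows in question have weight at least [16 ^ (#|I| - a) >= 4 ^ #|I|]. *)
Lemma card_many_small (I : finType) (L a : nat) :
    a.*2 <= #|I| ->
  2 ^ #|I| * #|[pred x : {ffun I -> 'I_(16 * L)} |
                 #|I| - a <= #|[set g | x g < L]| ]| <= (16 * L) ^ #|I|.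
Proof.
move=> aI; set E := [pred x | _].
pose f (y : 'I_(16 * L)) := if y < L then 16 else 1.
have sum_f : \sum_y f y <= 2 * (16 * L).
  rewrite -(big_mkord xpredT (fun y => if y < L then 16 else 1)).
  rewrite (big_cat_nat (n := L)) //=; last by lia.
  rewrite (@eq_big_nat _ _ _ _ _ _ (fun=> 16)); last by move=> y /andP[_ ->].
  rewrite [X in _ + X](@eq_big_nat _ _ _ _ _ _ (fun=> 1)); last first.
    by move=> y /andP[yL _]; rewrite ltnNge yL.
  by rewrite !sum_nat_const_nat; lia.
have H : #|E| * 16 ^ (#|I| - a) <= (2 * (16 * L)) ^ #|I|.
  apply: (@leq_trans (\sum_(x : {ffun I -> 'I_(16 * L)}) \prod_g f (x g))).
    rewrite -sum1_card big_distrl /= [X in _ <= X](bigID [in E]) /=.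
    apply: leq_trans (leq_addr _ _); apply: leq_sum => x xE.
    rewrite mul1n (bigID (fun g => x g < L)) /=.
    rewrite (eq_bigr (fun=> 16)); last by move=> g; rewrite /f => ->.
    rewrite [X in _ * X]big1 ?muln1; last by move=> g; rewrite /f => /negbTE ->.
    rewrite prod_nat_const leq_pexp2l //.
    move: xE; rewrite !inE => /leq_trans; apply.
    by apply: eq_leq; apply: eq_card => g; rewrite !inE.
  rewrite -(bigA_distr_bigA (fun (_ : I) (y : 'I_(16 * L)) => f y)) /=.
  by rewrite -[X in _ <= X](prod_nat_const I); apply: leq_prod.
have H16 : 2 ^ #|I| * 2 ^ #|I| <= 16 ^ (#|I| - a).
  by rewrite (_ : 16 = 2 ^ 4) // -expnM -expnD leq_pexp2l //; lia.
have := leq_trans (leq_mul (leqnn #|E|) H16) H.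
by rewrite expnMn mulnCA leq_pmul2l ?expn_gt0 // mulnC.
Qed.

Lemma card_not_injective (I : finType) (L : nat) :
  L * #|[pred x : {ffun I -> 'I_L} | ~~ injectiveb x]| <= #|I| ^ 2 * L ^ #|I|.
Proof.
pose E (p : I * I) := [pred x : {ffun I -> 'I_L} | (p.1 != p.2) && (x p.1 == x p.2)].
have HE p : L * #|E p| <= L ^ #|I|.
  have -> : L ^ #|I| = #|{ffun I -> 'I_L}| by rewrite card_ffun card_ord.
  have -> : L * #|E p| = #|[predX E p & 'I_L]| by rewrite cardX card_ord mulnC.
  (* Overwriting [x p.1] by a free value is injective on the rows with a tie at [p], since the
     erased value survives at [p.2]. *)
  pose h (q : {ffun I -> 'I_L} * 'I_L) := upd q.1 p.1 q.2.
  rewrite -(card_in_image (f := h)) ?max_card // => -[x y] [x' y'] /=.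
  rewrite !inE /= !andbT => /andP[pp /eqP xp] /andP[_ /eqP xp'] /ffunP e.
  have := e p.1; have := e p.2; rewrite !ffunE eqxx eq_sym (negbTE pp) /= => e2 ->.
  congr pair; apply/ffunP => g; have := e g; rewrite !ffunE.
  by case: eqP => // -> _; rewrite xp xp'.
apply: (@leq_trans (L * \sum_p #|E p|)).
  rewrite leq_mul2l; apply/orP; right; rewrite -sum1_card.
  under [X in _ <= X]eq_bigr do rewrite -sum1_card.
  rewrite (exchange_big_dep xpredT) //= big_mkcond /=; apply: leq_sum => x _.
  rewrite inE; case: ifP => // /injectivePn[g [h gh e]].
  by rewrite (bigD1 (g, h)) //= inE /= gh e eqxx.
rewrite big_distrr /= -mulnn -card_prod -sum_nat_const.
by apply: leq_sum.
Qed.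

Local Open Scope ring_scope.

(** * Turn counts and the sequence of items taken in a run *)

Section Run.
Variables (R : realType) (n m' : nat).
Local Notation m := m'.+1.
Implicit Types (s : 'I_m -> 'I_n) (u : 'I_n -> 'I_m -> R).

Lemma picks_beforeE s k i :
  picks_before s k i = #|[pred k' : 'I_m | (k' < k)%N && (s k' == i)]|.
Proof. by apply: eq_card => k'; apply/asboolP/idP. Qed.

Lemma picks_before0 s i : picks_before s 0 i = 0%N.
Proof. by rewrite picks_beforeE eq_card0. Qed.

Lemma picks_beforeS s k i : (k < m)%N ->
  picks_before s k.+1 i = (picks_before s k i + (s (inord k) == i))%N.
Proof.
move=> km; rewrite !picks_beforeE [LHS](cardD1 (inord k)) !inE inordK // ltnSn /= addnC.
congr addn; apply: eq_card => k'; rewrite !inE ltnS leq_eqVlt -val_eqE /= inordK //.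
by case: ltngtP.
Qed.

Lemma picks_before_mono s i k k' : (k <= k')%N ->
  (picks_before s k i <= picks_before s k' i)%N.
Proof.
move=> kk'; rewrite !picks_beforeE; apply/subset_leq_card/fintype.subsetP => h.
by rewrite !inE => /andP[hk ->]; rewrite andbT (leq_trans hk).
Qed.

Lemma sum_picks_before s k : (k <= m)%N -> (\sum_i picks_before s k i = k)%N.
Proof.
elim: k => [|k IH] km; first by rewrite big1 // => i _; rewrite picks_before0.
under eq_bigr do rewrite picks_beforeS //.
rewrite big_split /= IH 1?ltnW // (bigD1 (s (inord k))) //= eqxx big1 ?addn0 ?addn1 //.
by move=> i; rewrite eq_sym => /negbTE ->.
Qed.

(** Replaces the recursive list by the sequence of items in the order taken; the last clause is all
    that is kept of the greedy rule. *)
Lemma wps_runP u s : exists p : nat -> 'I_m,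
  [/\ forall k, (k <= m)%N -> wps_run u s k = [seq (s (inord k'), p k') | k' <- iota 0 k],
      forall k k', (k < k' < m)%N -> p k != p k' &
      forall k g, (k < m)%N -> (forall k', (k' < k)%N -> p k' != g) ->
        u (s (inord k)) g <= u (s (inord k)) (p k)].
Proof.
pose i0 := s ord0.
pose p k := (last (i0, ord0) (wps_run u s k.+1)).2.
have step k : (k < m)%N -> size (wps_run u s k) = k -> exists g,
   [/\ wps_run u s k.+1 = rcons (wps_run u s k) (s (inord k), g),
    g \notin unzip2 (wps_run u s k) &
    forall h, h \notin unzip2 (wps_run u s k) -> u (s (inord k)) h <= u (s (inord k)) g].
  move=> km sz /=; rewrite insubT.
  have -> : Sub k km = inord k :> 'I_m by apply/val_inj; rewrite /= inordK.
  set T := wps_run u s k in sz *.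
  case: pickP => [g0 g0T|T_full].
    case: arg_maxP => // g gT gmax; exists g; split=> // h hT; exact: gmax.
  (* Pigeonhole: [k < m] picks cannot have exhausted the [m] items. *)
  suff : (m <= k)%N by rewrite leqNgt km.
  rewrite -sz -(size_map snd) -[X in (X <= _)%N]card_ord.
  apply: leq_trans (card_size _); apply/subset_leq_card/fintype.subsetP => h _.
  by have := T_full h; move/negbFE.
have sz k : (k <= m)%N -> size (wps_run u s k) = k.
  elim: k => // k IH km.
  by have [g [-> _ _]] := step k km (IH (ltnW km)); rewrite size_rcons IH // ltnW.
have pE k : (k < m)%N -> [/\ wps_run u s k.+1 = rcons (wps_run u s k) (s (inord k), p k),
    p k \notin unzip2 (wps_run u s k) &
    forall h, h \notin unzip2 (wps_run u s k) -> u (s (inord k)) h <= u (s (inord k)) (p k)].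
  move=> km; have [g [e gT gmax]] := step k km (sz k (ltnW km)).
  by rewrite /p e last_rcons.
have runE k : (k <= m)%N -> wps_run u s k = [seq (s (inord k'), p k') | k' <- iota 0 k].
  elim: k => // k IH km; have [-> _ _] := pE k km.
  by rewrite IH 1?ltnW // -[k.+1]addn1 iotaD map_cat /= cats1.
have unzE k : (k <= m)%N -> unzip2 (wps_run u s k) = [seq p k' | k' <- iota 0 k].
  by move=> km; rewrite runE // /unzip2 -map_comp.
exists p; split => // [k k' /andP[kk' k'm]|k g km pg].
  have [_ + _] := pE k' k'm; rewrite unzE 1?ltnW //; apply: contraNN => /eqP <-.
  by apply: map_f; rewrite mem_iota.
have [_ _] := pE k km; apply; rewrite unzE 1?ltnW //.
apply/mapP => -[k']; rewrite mem_iota /= add0n => k'k e.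
by have := pg k' k'k; rewrite e eqxx.
Qed.

Lemma util_wps_alloc u u' s (p : nat -> 'I_m) :
    (forall k, (k <= m)%N -> wps_run u s k = [seq (s (inord k'), p k') | k' <- iota 0 k]) ->
    (forall k k', (k < k' < m)%N -> p k != p k') ->
  forall i j, util u' i (wps_alloc u s j) =
    \sum_(k < m) (if s (inord k) == j then u' i (p k) else 0).
Proof.
move=> runE p_neq i j.
have p_inj : injective (fun k : 'I_m => p k).
  move=> k k' e; apply/val_inj => /=; have [lt|lt|//] := ltngtP k k'.
    by have := p_neq k k'; rewrite lt ltn_ord e eqxx => /(_ isT).
  by have := p_neq k' k; rewrite lt ltn_ord e eqxx => /(_ isT).
rewrite /util big_mkcond (reindex_inj p_inj) /=.
apply: eq_bigr => k _; rewrite inE runE //; congr (if _ then _ else _).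
apply/mapP/eqP => [[k']|<-]; last by exists (val k) => //; rewrite mem_iota /=.
rewrite mem_iota /= add0n => k'm [-> e]; congr (s (inord _)).
by have /(congr1 val) := @p_inj k (Ordinal k'm) e.
Qed.

End Run.

(** * The charging argument for a pair of agents *)

Fixpoint last_value (T : Type) (b : pred nat) (x0 : T) (a : nat -> T) (k : nat) : T :=
  if k is k'.+1 then (if b k' then a k' else last_value b x0 a k') else x0.

(** With [b] marking the picks of an agent, [last_value] is her cap, with a default before her first
    pick. Two sequences are treated at once so that the caps in utilities and in cells come from the
    same step [k0]. *)
Lemma last_valueP (T T' : Type) (b : pred nat) (x0 : T) (a : nat -> T)
    (y0 : T') (a' : nat -> T') k :
  (forall k', (k' < k)%N -> ~~ b k') \/
  exists k0, [/\ (k0 < k)%N, b k0, last_value b x0 a k = a k0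
                & last_value b y0 a' k = a' k0].
Proof.
elim: k => [|k [IH|[k0 [k0k bk0 e e']]]] /=; first by left.
- have [bk|bk] := boolP (b k); first by right; exists k.
  by left=> k'; rewrite ltnS leq_eqVlt => /predU1P[->|/IH].
- right; have [bk|bk] := boolP (b k); first by exists k.
  by exists k0; rewrite ltnW // ltnS ltnW.
Qed.

Section Fairness.
Variables (R : realType) (n m' : nat).
Local Notation m := m'.+1.
Variables (w : 'I_n -> R) (s : 'I_m -> 'I_n).
Hypotheses (w_gt0 : forall i, 0 < w i) (s_valid : valid_wps w s).

Lemma valid_picks_before k j : (k < m)%N ->
  (picks_before s k (s (inord k)))%:R / w (s (inord k)) <= (picks_before s k j)%:R / w j.
Proof. by move=> km; have := s_valid (inord k) j; rewrite inordK. Qed.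

(** When [j] picks, her count before the pick is minimal relative to weight, and it is the
    predecessor of her new count; at all other steps only the right side can grow. *)
Lemma picks_before_pred_le k i j : (k <= m)%N ->
  ((picks_before s k j).-1)%:R / w j <= (picks_before s k i)%:R / w i.
Proof.
elim: k => [|k IH] km; first by rewrite !picks_before0 !mul0r.
have := IH (ltnW km); rewrite !picks_beforeS //.
have [sj|sj] := eqVneq (s (inord k)) j; last first.
  rewrite addn0 => /le_trans; apply.
  by rewrite ler_pM2r ?invr_gt0 // ler_nat leq_addr.
move=> _; rewrite addn1 /= -{1 2}sj; apply: le_trans (valid_picks_before i km) _.
by rewrite ler_pM2r ?invr_gt0 // ler_nat leq_addr.
Qed.

(** If [j] had at most [l] picks, [picks_before_pred_le] would leave every agent at most [C * l + 1]
    picks, too few to fill [k] steps. *)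
Lemma picks_before_gt (C : R) (k l : nat) (j : 'I_n) :
    (forall i j, w i <= C * w j) -> (k <= m)%N -> 1 <= C ->
    n%:R * (C * l%:R + 1) < k%:R ->
  (l < picks_before s k j)%N.
Proof.
move=> wC km C1 lt_k; rewrite ltnNge; apply/negP => le_l; move: lt_k.
apply/negP; rewrite -leNgt -{1}(sum_picks_before s km) natr_sum.
have le_i i : (picks_before s k i)%:R <= C * l%:R + 1 :> R.
  have := picks_before_pred_le j i km.
  rewrite ler_pdivrMr // => le1.
  have le2 : (picks_before s k j)%:R / w j * w i <= l%:R * C.
    rewrite -mulrA; apply: ler_pM; rewrite ?ler0n ?ler_nat //.
      by rewrite mulr_ge0 ?invr_ge0 ?ltW.
    by rewrite mulrC ler_pdivrMr.
  have le3 : (picks_before s k i)%:R <= ((picks_before s k i).-1)%:R + 1 :> R.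
    by rewrite natr1 ler_nat leqSpred.
  lra.
apply: (@le_trans _ _ (\sum_(i < n) (C * l%:R + 1))).
  by apply: ler_sum => i _; exact: le_i.
by rewrite sumr_const card_ord mulr_natl.
Qed.

Variables (i j : 'I_n) (a : nat -> R).
Hypothesis ij : i != j.
Hypothesis a01 : forall k, 0 <= a k <= 1.
Hypothesis a_desc : forall k k', (k < k' < m)%N -> s (inord k) = i -> a k' <= a k.

Let z := last_value (fun k => s (inord k) == i) 1 a.

Lemma last_value_ge k k' : (k <= k' < m)%N -> a k' <= z k.
Proof.
move=> /andP[kk' k'm]; rewrite /z.
have [_|[k0 [k0k /eqP sk0 -> _]]] := last_valueP (fun k => s (inord k) == i) 1 a 1 a k.
  elim: k kk' => [|k IH] kk' /=; first by have /andP[] := a01 k'.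
  by case: eqP => [|_]; [move=> /a_desc; apply; rewrite kk' | apply: IH; rewrite ltnW].
by apply: a_desc => //; rewrite k'm (leq_trans k0k).
Qed.

Lemma last_value_ge0 k : 0 <= z k.
Proof.
by rewrite /z; elim: k => [|k IH] //=; case: ifP => // _; have /andP[] := a01 k.
Qed.

(* Charging each pick of [j] but the first at the value of the preceding pick
   of [i] keeps [i] ahead. *)
Lemma charged_picks_le k : (k <= m)%N ->
  z k * ((picks_before s k i)%:R / w i - ((picks_before s k j).-1)%:R / w j) <=
  (\sum_(k' < k) (if s (inord k') == i then a k' else 0)) / w i -
  (\sum_(k' < k) (if (s (inord k') == j) && (0 < picks_before s k' j)%N
                  then z k' else 0)) / w j.
Proof.
elim: k => [|k IH] km.
  by rewrite !big_ord0 !picks_before0 /= !mul0r subrr mulr0.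
have {}IH := IH (ltnW km).
have le_ij := picks_before_pred_le i j (ltnW km).
rewrite !big_ord_recr /= !picks_beforeS //.
have [si|si] := eqVneq (s (inord k)) i.
  rewrite si (negbTE ij) /= addn0 addr0 addn1 -natr1 !mulrDl mul1r.
  have -> : z k.+1 = a k by rewrite /z /= si eqxx.
  have le_z : a k <= z k by apply: last_value_ge; rewrite leqnn.
  move: IH le_ij; set A := _%:R / w i; set B := _%:R / w j.
  set P := (\sum_(_ < _) _) / w i; set Q := (\sum_(_ < _) _) / w j => IH le_ij.
  have : a k * (A - B) <= z k * (A - B) by rewrite ler_wpM2r // subr_ge0.
  by move: IH; rewrite [a k * (A + _ - B)]mulrDr mulrDr; lra.
have -> : z k.+1 = z k by rewrite /z /= (negbTE si).
rewrite addn0 addr0; have [sj|sj] := eqVneq (s (inord k)) j; last first.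
  by rewrite /= addn0 addr0.
rewrite addn1 /=; case: (posnP (picks_before s k j)) => [e|Tj].
  by move: IH; rewrite e addr0.
move: IH; rewrite -{2}(prednK Tj) -natr1 !mulrDl mul1r opprD addrA mulrDr mulrN.
by rewrite [z k / w j]mulrC; lra.
Qed.

(** Raising each pick of [j] after the first to its cap adds exactly the gains. Being at least 1,
    these cover the first pick, and [charged_picks_le] compares the caps with the bundle of [i]. *)
Lemma weighted_envy_le :
    1 <= \sum_(k < m) (if (s (inord k) == j) && (0 < picks_before s k j)%N
                       then z k - a k else 0) ->
  (\sum_(k < m) (if s (inord k) == j then a k else 0)) / w j <=
  (\sum_(k < m) (if s (inord k) == i then a k else 0)) / w i.
Proof.
move=> gain1; have := charged_picks_le (leqnn m).
set X := (X in _ <= X / w i - _); set Z := (X in _ <= _ - X / w j).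
set Y := (X in X / w j <= _).
have := picks_before_pred_le i j (leqnn m); rewrite -subr_ge0.
move=> /(mulr_ge0 (last_value_ge0 m)) ge0 /(le_trans ge0); rewrite subr_ge0.
apply: le_trans; rewrite ler_pM2r ?invr_gt0 //.
(* Only one pick of [j] has no pick of hers before it, so these terms amount to a single value of at
   most 1. *)
have first_le1 k : (k <= m)%N ->
    \sum_(k' < k) (if (s (inord k') == j) && (picks_before s k' j == 0)%N then a k' else 0)
      <= (0 < picks_before s k j)%N%:R.
  elim: k => [|k IH] km; first by rewrite big_ord0.
  rewrite big_ord_recr /= picks_beforeS //; have {}IH := IH (ltnW km).
  case: (s (inord k) == j) => /=; last by rewrite addr0 addn0.
  rewrite addn1 /=; case: (posnP (picks_before s k j)) IH => [_|T0 IH] /=.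
    by have /andP[_] := a01 k; rewrite mulr0n mulr1n; lra.
  by rewrite addr0.
have {first_le1} := first_le1 m (leqnn m); set F := \sum_(_ < _) _ => F1.
have {}F1 : F <= 1 by apply: le_trans F1 _; rewrite lern1 leq_b1.
have YE : Y = F + (Z - \sum_(k < m) (if (s (inord k) == j) && (0 < picks_before s k j)%N
                       then z k - a k else 0)).
  rewrite /Y /F /Z -sumrB -big_split; apply: eq_bigr => k _ /=.
  case: (s (inord k) == j) => /=; last by rewrite subrr addr0.
  by case: (posnP (picks_before s k j)) => [_|T0] /=; lra.
rewrite YE; lra.
Qed.

End Fairness.

(** * From an actual run to the turns and the budget of [low_gain] *)

Definition best (I : finType) (L : nat) (x : {ffun I -> 'I_L}) (g0 : I)
    (S : {set I}) : I :=
  odflt g0 [pick g in S | [forall h in S, (x h <= x g)%N]].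

(** A strict maximum leaves no freedom, so [best] agrees with the pick of the run whatever rule
    breaks ties. *)
Lemma bestE (I : finType) (L : nat) (x : {ffun I -> 'I_L}) (g0 g : I)
    (S : {set I}) :
    g \in S -> (forall h, h \in S -> h != g -> (x h < x g)%N) ->
  best x g0 S = g.
Proof.
move=> gS gmax; rewrite /best; case: pickP => [h|/(_ g)] /=.
  move=> /andP[hS /forall_inP /(_ g gS)]; apply: contraTeq => hg.
  by rewrite -ltnNge gmax.
rewrite gS /= => /negP[]; apply/forall_inP => h hS.
by have [->|hg] := eqVneq h g; rewrite ?leqnn // ltnW // gmax.
Qed.

Section Link.
Variables (n m' L' l : nat).
Local Notation m := m'.+1.
Local Notation L := (16 * L')%N.
Variables (s : 'I_m -> 'I_n).
Implicit Types (v : {ffun 'I_n -> {ffun 'I_m -> 'I_L}}) (i j : 'I_n).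

(** The first pick of [j] is left out because [i] may not have picked before it; stopping at count
    [l] leaves picks 2 to [l + 1], thus [l] of them. *)
Definition counted_step j (k : nat) : bool :=
  (s (inord k) == j) && (0 < picks_before s k j <= l)%N.

Definition turn_at v i j (k : nat) : turn 'I_m :=
  let o := best (v (s (inord k))) ord0 in
  if s (inord k) == i then @Me _
  else if counted_step j k then Counted o else Other o.

Definition turns v i j : seq (turn 'I_m) :=
  [seq turn_at v i j k | k <- iota 0 m].

(** Turns of [i] carry no choice function, so the list stays fixed while row [i] is resampled. *)
Lemma turns_upd v i j x : turns (upd v i x) i j = turns v i j.
Proof.
apply: eq_map => k; rewrite /turn_at ffunE.
by case: (s (inord k) == i).
Qed.

Lemma sum_counted_step j k : (k <= m)%N ->
  (\sum_(k' < k) counted_step j k' = (minn (picks_before s k j) l.+1).-1)%N.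
Proof.
elim: k => [|k IH] km; first by rewrite big_ord0 picks_before0.
rewrite big_ord_recr /= IH 1?ltnW // picks_beforeS // /counted_step.
case: (s (inord k) == j) => /=; lia.
Qed.

Lemma count_turns v i j : i != j -> (l < picks_before s m j)%N ->
  count (@is_counted _) (turns v i j) = l.
Proof.
move=> ij lt_l; rewrite /turns count_map -sum1_count.
transitivity (\sum_(0 <= k < m) counted_step j k)%N; last first.
  by rewrite big_mkord sum_counted_step //; lia.
rewrite /index_iota subn0 big_mkcond; apply: eq_bigr => k _ /=.
rewrite /turn_at /counted_step.
have [->|] := eqVneq (s (inord k)) i; first by rewrite (negbTE ij).
by case: (_ && _).
Qed.

Variables (v : {ffun 'I_n -> {ffun 'I_m -> 'I_L}}) (p : nat -> 'I_m).
Hypothesis p_neq : forall k k', (k < k' < m)%N -> p k != p k'.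
Let remaining k := [set g : 'I_m | [forall k' : 'I_k, p k' != g]].
Hypothesis p_best : forall k g, (k < m)%N -> g \in remaining k -> g != p k ->
  (v (s (inord k)) g < v (s (inord k)) (p k))%N.

Lemma remaining0 : remaining 0 = [set: 'I_m].
Proof. by apply/setP => g; rewrite !inE; apply/forallP => -[]. Qed.

Lemma remainingS k : remaining k.+1 = remaining k :\ p k.
Proof.
apply/setP => g; rewrite !inE; apply/forallP/andP => [H|[gp /forallP H] k'].
  split; first by have := H ord_max; rewrite eq_sym.
  by apply/forallP => k'; exact: (H (widen_ord (leqnSn k) k')).
have [lt|] := ltnP k' k; first exact: (H (Ordinal lt)).
rewrite leq_eqVlt ltnNge -ltnS ltn_ord orbF => /eqP <-.
by rewrite eq_sym.
Qed.

Lemma mem_remaining k : (k < m)%N -> p k \in remaining k.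
Proof.
move=> km; rewrite inE; apply/forallP => k'; apply: p_neq.
by rewrite ltn_ord km.
Qed.

Lemma card_remaining k : (k <= m)%N -> #|remaining k| = (m - k)%N.
Proof.
elim: k => [|k IH] km; first by rewrite remaining0 cardsT card_ord subn0.
rewrite remainingS; have := IH (ltnW km); rewrite (cardsD1 (p k)) mem_remaining //.
by rewrite add1n => /(congr1 predn) /= ->; rewrite subnS.
Qed.

Variables (i j : 'I_n) (a c : nat).
Hypotheses (ij : i != j) (am : (a <= m)%N) (lt_l : (l < picks_before s a j)%N).
Hypothesis not_small : (#|[set g | (v i g < L')%N]| < m - a)%N.

Let zv := last_value (fun k => s (inord k) == i) L (fun k => v i (p k) : nat).
Let loss k := if counted_step j k then (zv k - v i (p k))%N else 0%N.

Lemma remaining_lt_cap k g : (k <= m)%N -> g \in remaining k -> (v i g < zv k)%N.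
Proof.
elim: k => [|k IH] km gk; first by rewrite /zv /=.
move: gk; rewrite remainingS !inE => /andP[gp gk]; rewrite /zv /=.
have [sk|_] := eqVneq (s (inord k)) i; last by apply: IH; rewrite ?inE // ltnW.
by rewrite -sk; apply: p_best; rewrite ?inE.
Qed.

(** A counted pick falls before step [a], by which [j] has more than [l] picks. More than [m - a]
    items then remain, all below the cap, so a cap of at most [L'] would make too many of them
    small. *)
Lemma cap_ge k : (k < m)%N -> counted_step j k -> (L <= 16 * zv k)%N.
Proof.
move=> km /andP[_ /andP[_ Tl]]; rewrite leq_mul2l /= leqNgt; apply/negP => small.
have ka : (k < a)%N.
  rewrite ltnNge; apply/negP => /(picks_before_mono s j) le; lia.
suff : (m - k <= #|[set g | (v i g < L')%N]|)%N by lia.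
rewrite -(card_remaining (ltnW km)); apply/subset_leq_card/fintype.subsetP => g gk.
by rewrite inE (ltn_trans _ small) // remaining_lt_cap // ltnW.
Qed.

Lemma low_gain_turns : (\sum_(k < m) loss k <= c)%N ->
  low_gain 16 (turns v i j) [set: 'I_m] L c (v i).
Proof.
move=> loss_c.
(* Induction along suffixes of the run; the state at step [k] consists of the remaining items, the
   cap and the unspent budget. *)
suff H d k : (k + d = m)%N ->
    low_gain 16 [seq turn_at v i j k' | k' <- iota k d] (remaining k) (zv k)
      (c - \sum_(k' < k) loss k') (v i).
  by have := H m 0%N (add0n _); rewrite big_ord0 subn0 remaining0.
elim: d k => [//|d IH] k kd; have km : (k < m)%N by lia.
have {}IH := IH k.+1; rewrite addSnnS in IH; have {}IH := IH kd.
rewrite big_ord_recr /= remainingS in IH.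
have loss_le : (\sum_(k' < k) loss k' + loss k <= c)%N.
  have -> : (\sum_(k' < k) loss k' + loss k = \sum_(k' < k.+1) loss k')%N.
    by rewrite big_ord_recr.
  apply: leq_trans loss_c; rewrite (big_ord_widen m loss km).
  by rewrite [X in (_ <= X)%N](bigID (fun k' : 'I_m => (k' < k.+1)%N)) /= leq_addr.
rewrite /= /turn_at; case: ifP => [/eqP sk|sk].
  apply/existsP; exists (p k); rewrite mem_remaining //=; apply/andP; split.
    apply/forall_inP => h; rewrite !inE => /andP[hp hk]; rewrite -sk.
    by apply: p_best => //; rewrite inE.
  move: IH; rewrite /zv /= sk eqxx /loss /counted_step sk (negbTE ij) /= addn0; exact.
have bE : best (v (s (inord k))) ord0 (remaining k) = p k.
  by apply: bestE; [exact: mem_remaining | move=> h; exact: p_best].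
have zE : zv k.+1 = zv k by rewrite /zv /= sk.
rewrite zE in IH; move: loss_le IH.
set D := (\sum_(k' < k) loss k')%N; rewrite /loss.
case: ifP => [ck|ck] loss_le IH /=; rewrite bE mem_remaining //=; last first.
  by rewrite addn0 in IH.
rewrite cap_ge //= subnDA in IH *; apply/andP; split=> //.
by rewrite addnC -leq_subLR leq_subRL // (leq_trans (leq_addr _ _) loss_le).
Qed.

End Link.

(** * Three bad events for a matrix of cells, and fairness outside them *)

Section GoodMatrix.
Variables (R : realType) (n m' L' l a c : nat).
Local Notation m := m'.+1.
Local Notation L := (16 * L')%N.
Variables (w : 'I_n -> R) (s : 'I_m -> 'I_n).
Implicit Types (v : {ffun 'I_n -> {ffun 'I_m -> 'I_L}}) (i j : 'I_n).

Definition tied v i := ~~ injectiveb (v i).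

Definition many_small v i := (m - a <= #|[set g | (v i g < L')%N]|)%N.

(** Once ties and many small values are excluded, envy of [i] towards [j] forces this event: the
    counted picks gain at most [c] cells in total. *)
Definition envious v i j :=
  (i != j) && low_gain 16 (turns l s v i j) [set: 'I_m] L c (v i).

Variables (C beta : R).
Hypotheses (w_gt0 : forall i, 0 < w i) (wC : forall i j, w i <= C * w j).
Hypotheses (s_valid : valid_wps w s) (C1 : 1 <= C) (beta_gt0 : 0 < beta).
Hypotheses (am : (a <= m)%N) (a_big : n%:R * (C * l%:R + 1) < a%:R :> R).
Hypothesis c_big : beta * L%:R + l%:R <= c%:R.

(** A difference of [d] cells guarantees a utility difference of [(d - 1) / (beta * L)]. After
    losing one cell at each of the [l] counted picks, a total above [c] still means gains of at
    least 1, by [c_big]. *)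
Lemma good_matrix_WEF v (u : 'I_n -> 'I_m -> R) :
    (forall i g, 0 <= u i g <= 1) ->
    (forall i g h, (v i g < v i h)%N -> u i g < u i h /\
       (v i h)%:R - (v i g)%:R - 1 <= beta * L%:R * (u i h - u i g)) ->
    (forall i, ~~ tied v i) -> (forall i, ~~ many_small v i) ->
    (forall i j, ~~ envious v i j) ->
  WEF w u (wps_alloc u s).
Proof.
move=> u01 cell no_tie no_small no_envy i j.
have [-> //|ij] := eqVneq i j.
have [p [runE p_neq p_max]] := wps_runP u s.
rewrite !(util_wps_alloc u runE p_neq).
have v_mono i' g h : g != h -> u i' g <= u i' h -> (v i' g < v i' h)%N.
  move=> gh le_u; rewrite ltnNge; apply/negP.
  rewrite leq_eqVlt => /predU1P[/val_inj e|/cell[]]; last by rewrite ltNge le_u.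
  by have /injectiveP/(_ _ _ e) := negbNE (no_tie i'); apply/eqP; rewrite eq_sym.
have p_best k g : (k < m)%N -> g \in [set g : 'I_m | [forall k' : 'I_k, p k' != g]] ->
    g != p k -> (v (s (inord k)) g < v (s (inord k)) (p k))%N.
  rewrite inE => km /forallP gk gp; apply: v_mono => //; apply: p_max => // k' k'k.
  exact: (gk (Ordinal k'k)).
have lt_l : (l < picks_before s a j)%N by apply: (picks_before_gt w_gt0 s_valid (C := C)).
have not_small : (#|[set g | (v i g < L')%N]| < m - a)%N.
  by have := no_small i; rewrite /many_small -ltnNge.
have := no_envy i j; rewrite /envious ij /=.
set zv := last_value (fun k => s (inord k) == i) L (fun k => v i (p k) : nat).
set z := last_value (fun k => s (inord k) == i) 1 (fun k => u i (p k)).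
have := low_gain_turns p_neq p_best ij am lt_l not_small (c := c).
rewrite -/zv; set D := (\sum_(k < m) _)%N => lg /(contra lg); rewrite -ltnNge => cD.
have p_later k k' : (k < k' < m)%N -> p k' \in [set g : 'I_m | [forall k'' : 'I_k, p k'' != g]].
  move=> /andP[kk' k'm]; rewrite inE; apply/forallP => k''; apply: p_neq.
  by rewrite k'm andbT (ltn_trans _ kk').
have a_desc k k' : (k < k' < m)%N -> s (inord k) = i -> u i (p k') <= u i (p k).
  move=> kk' <-; apply: p_max; first by case/andP: kk' => /ltn_trans; apply.
  by move=> k'' k''k; have := p_later k k' kk'; rewrite inE => /forallP/(_ (Ordinal k''k)).
apply: (weighted_envy_le (i := i) (j := j) (a := fun k => u i (p k)) w_gt0 s_valid ij) => //.
rewrite -/z.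
have L_gt0 : 0 < L%:R :> R by rewrite ltr0n; case: (L) (v i ord0) => [[]|].
have bL_gt0 : 0 < beta * L%:R by rewrite mulr_gt0.
rewrite -(ler_pM2l bL_gt0) mulr1 mulr_sumr.
have sum_l : \sum_(k < m) (counted_step l s j k)%:R <= l%:R :> R.
  rewrite -natr_sum ler_nat sum_counted_step //; lia.
apply: (@le_trans _ _ (D%:R - \sum_(k < m) (counted_step l s j k)%:R)).
  have : c%:R + 1 <= D%:R :> R by rewrite natr1 ler_nat.
  by move: c_big sum_l; lra.
rewrite /D natr_sum -sumrB; apply: ler_sum => k _.
have z_ge : u i (p k) <= z k.
  by apply: (last_value_ge (a := fun k => u i (p k)) (fun k => u01 i (p k)) a_desc);
    rewrite leqnn /=.
case: ifP => [ck|_]; last first.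
  by rewrite subr0; case: ifP => _; rewrite ?mulr0 // mulr_ge0 ?subr_ge0 // ltW.
move: ck => /andP[/eqP sk /andP[T_gt0 T_le]]; rewrite sk eqxx T_gt0 /=.
(* [j] was minimal at her pick with a positive count, so [i] has picked too; the cap is the value of
   a real pick and not the default. *)
have Ti_gt0 : (0 < picks_before s k i)%N.
  have := valid_picks_before s_valid i (ltn_ord k); rewrite sk.
  have := divr_gt0 (_ : 0 < (picks_before s k j)%:R) (w_gt0 j).
  rewrite ltr0n => /(_ T_gt0) h /(lt_le_trans h).
  by rewrite pmulr_lgt0 ?invr_gt0 // ltr0n.
rewrite /zv /z.
have [none|[k0 [k0k /eqP sk0 -> ->]]] :=
  last_valueP (fun k => s (inord k) == i) L (fun k => v i (p k) : nat) 1 (fun k => u i (p k)) k.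
  move: Ti_gt0; rewrite picks_beforeE => /card_gt0P[k']; rewrite !inE => /andP[k'k].
  by have := none k' k'k; rewrite inord_val => /negbTE ->.
have lt_v : (v i (p k) < v i (p k0))%N.
  rewrite -sk0; apply: p_best; rewrite ?(ltn_trans k0k) //.
    by apply: p_later; rewrite k0k ltn_ord.
  by rewrite eq_sym p_neq // k0k ltn_ord.
by rewrite natrB 1?ltnW //; have [_] := cell _ _ _ lt_v.
Qed.

End GoodMatrix.

(** * Union bound over the bad matrices *)

Section Count.
Variables (n m' L' l a c : nat).
Local Notation m := m'.+1.
Local Notation L := (16 * L')%N.
Local Notation M := {ffun 'I_n -> {ffun 'I_m -> 'I_L}}.
Variable s : 'I_m -> 'I_n.

Lemma card_tied (i : 'I_n) :
  (L * #|[pred v : M | tied v i]| <= m ^ 2 * #|{: M}|)%N.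
Proof.
apply: (card_upd_le (i := i)) => v.
rewrite card_ffun !card_ord.
have := @card_not_injective 'I_m L; rewrite card_ord; apply: leq_trans.
rewrite leq_mul2l; apply/orP; right.
apply/subset_leq_card/fintype.subsetP => x.
by rewrite !inE /tied ffunE eqxx.
Qed.

Lemma card_many_small_row (i : 'I_n) : (a.*2 <= m)%N ->
  (2 ^ m * #|[pred v : M | many_small a v i]| <= #|{: M}|)%N.
Proof.
move=> am; rewrite -[X in (_ <= X)%N]mul1n.
apply: (card_upd_le (i := i)) => v.
rewrite card_ffun !card_ord mul1n.
have := @card_many_small 'I_m L' a; rewrite card_ord => /(_ am); apply: leq_trans.
rewrite leq_mul2l; apply/orP; right.
apply/subset_leq_card/fintype.subsetP => x.
by rewrite !inE /many_small ffunE eqxx.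
Qed.

(** The other rows fix the turns, and [card_low_gain] starts from all items with cap [L], where
    [L ^ m] is the number of rows. *)
Lemma card_envious (i j : 'I_n) : (l < picks_before s m j)%N ->
  (L ^ l * #|[pred v : M | envious l c s v i j]| <= 16 ^ l * 'C(c, l) * #|{: M}|)%N.
Proof.
move=> lt_l; have [->|ij] := eqVneq i j.
  by rewrite [X in (_ * X)%N]eq_card0 ?muln0 // => v; rewrite inE /envious eqxx.
apply: (card_upd_le (i := i)) => v.
rewrite card_ffun !card_ord.
have := card_low_gain 16 (turns l s v i j) [set: 'I_m] L c (v i).
rewrite cardsT card_ord (count_turns v ij lt_l) [X in (_ <= X)%N]mulnC; apply: leq_trans.
rewrite leq_mul2l; apply/orP; right.
apply/subset_leq_card/fintype.subsetP => x.
rewrite !inE /envious ij turns_upd ffunE eqxx => /= ->; rewrite andbT.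
by apply/forallP => g; rewrite inE.
Qed.

Definition good (v : M) := [forall i, ~~ tied v i && ~~ many_small a v i]
  && [forall i, forall j, ~~ envious l c s v i j].

Lemma card_not_good (R : realType) : (0 < L')%N -> (a.*2 <= m)%N ->
    (forall j, (l < picks_before s m j)%N) ->
  #|[pred v | ~~ good v]|%:R <=
  (n%:R * m%:R ^+ 2 / L%:R + n%:R / 2 ^+ m
   + n%:R ^+ 2 * (16 ^+ l * 'C(c, l)%:R / L%:R ^+ l)) * #|{: M}|%:R :> R.
Proof.
move=> L0 am lt_l.
have LR : 0 < L%:R :> R by rewrite ltr0n muln_gt0.
apply: (@le_trans _ _ ((\sum_i #|[pred v : M | tied v i]| + \sum_i #|[pred v : M | many_small a v i]|
   + \sum_i \sum_j #|[pred v : M | envious l c s v i j]|)%N%:R)).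
  rewrite ler_nat -big_split /= -big_split /=.
  apply: (@leq_trans (\sum_(v : M) \sum_(i < n)
     (tied v i + many_small a v i + \sum_j envious l c s v i j))%N); last first.
    rewrite exchange_big /=; apply: leq_sum => i _; rewrite !big_split /=.
    rewrite exchange_big /=.
    apply: eq_leq; congr (_ + _ + _)%N.
    - by rewrite -sum1_card [RHS]big_mkcond; apply: eq_bigr => v _; rewrite inE; case: (tied v i).
    - by rewrite -sum1_card [RHS]big_mkcond; apply: eq_bigr => v _; rewrite inE; case: (many_small a v i).
    - apply: eq_bigr => j _.
      by rewrite -sum1_card [RHS]big_mkcond; apply: eq_bigr => v _; rewrite inE; case: (envious _ _ _ _ _ _).
  rewrite -sum1_card big_mkcond; apply: leq_sum => v _; rewrite inE.
  case: ifP => //; rewrite /good negb_and => /orP[/forallPn[i]|/forallPn[i /forallPn[j]]].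
    rewrite negb_and !negbK => h; rewrite (bigD1 i) //=.
    by case/orP: h => -> /=; lia.
  rewrite negbK => h; rewrite (bigD1 i) //= (bigD1 j) //= h; lia.
have ti i : #|[pred v : M | tied v i]|%:R <= m%:R ^+ 2 / L%:R * #|{: M}|%:R :> R.
  rewrite mulrAC ler_pdivlMr // mulrC -natrX -!natrM ler_nat.
  exact: card_tied.
have sm i : #|[pred v : M | many_small a v i]|%:R <= 1 / 2 ^+ m * #|{: M}|%:R :> R.
  rewrite mulrAC ler_pdivlMr ?exprn_gt0 // mul1r mulrC -natrX -!natrM ler_nat.
  exact: card_many_small_row.
have en i j : #|[pred v : M | envious l c s v i j]|%:R <=
    16 ^+ l * 'C(c, l)%:R / L%:R ^+ l * #|{: M}|%:R :> R.
  rewrite mulrAC ler_pdivlMr ?exprn_gt0 // mulrC -!natrX -!natrM ler_nat.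
  exact: card_envious.
rewrite [X in X <= _]natrD [X in X + _ <= _]natrD !natr_sum !mulrDl lerD ?lerD //.
- apply: (le_trans (ler_sum _ (fun i _ => ti i))).
  by rewrite sumr_const card_ord -[X in X <= _]mulr_natl !mulrA.
- apply: (le_trans (ler_sum _ (fun i _ => sm i))).
  by rewrite sumr_const card_ord -[X in X <= _]mulr_natl mul1r !mulrA.
- under eq_bigr do rewrite natr_sum.
  apply: (le_trans (ler_sum _ (fun i _ => ler_sum _ (fun j _ => en i j)))).
  rewrite !sumr_const !card_ord -[X in X <= _]mulr_natl -[X in _ * X <= _]mulr_natl expr2.
  by rewrite !mulrA.
Qed.

End Count.

Local Open Scope classical_set_scope.
Local Open Scope ring_scope.

(** * Cutting [0,1] into cells of equal mass *)

Section Cells.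
Variables (R : realType) (D : probability (measurableTypeR R) R) (alpha beta : R).
Hypotheses (alpha_gt0 : 0 < alpha) (beta_gt0 : 0 < beta).
Hypothesis D_pdf : pdf_bounded_ab D alpha beta.

Lemma pdf_bounded_itv_le (a b : R) : a <= b ->
  (D [set` `]a, b]] <= (beta * (b - a))%:E)%E.
Proof.
move=> ab; have [_ [f [mf [f_ab D_f]]]] := D_pdf.
rewrite D_f; last exact: measurable_itv.
have mI : measurable (`]a, b] `&` `[0, 1] : set R) by apply: measurableI; exact: measurable_itv.
apply: (@le_trans _ _ (\int[@lebesgue_measure R]_(x in `]a, b] `&` `[0%R, 1%R]) (cst beta%:E x))%E).
  apply: ge0_le_integral => //.
  - move=> x [_ /=]; rewrite in_itv /= => /f_ab /andP[+ _].
    by rewrite lee_fin => /(le_trans (ltW alpha_gt0)).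
  - apply/measurable_EFinP; apply: measurable_funS mf; first exact: measurable_itv.
    exact: subIsetr.

  - by move=> x [_ /=]; rewrite in_itv /= => /f_ab /andP[_]; rewrite lee_fin.
rewrite integral_cst // EFinM lee_pmul2l ?lte_fin //.
apply: (@le_trans _ _ (lebesgue_measure (`]a, b] : set R))).
  by apply: le_measure; rewrite ?inE //; exact: measurable_itv.
rewrite lebesgue_measure_itv /= lte_fin; case: ifP => // _.
by rewrite lee_fin subr_ge0.
Qed.

Let F (x : R) : R := fine (D [set` `]-oo, x]]).

Let F_split (a b : R) : a <= b -> D [set` `]a, b]] = (F b - F a)%:E.
Proof.
move=> ab.
have fin (A : set R) : measurable A -> D A \is a fin_num by move=> mA; exact: fin_num_measure.
have -> : [set` `]a, b]] = `]-oo, b] `\` `]-oo, a] :> set R.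
  apply/seteqP; split => x /=; rewrite !in_itv /=.
    by move=> /andP[ax ->]; split=> //; rewrite leNgt ax.
  by move=> [-> /negP]; rewrite -ltNge => ->.
rewrite measureD //=.
- rewrite EFinB !fineK ?fin //; congr (_ - D _)%E.
  rewrite setIidr // => x /=; rewrite !in_itv /= => /le_trans; exact.
- by rewrite ltey_eq fin.
Qed.

(** The upper bound on the density makes the distribution function Lipschitz, hence continuous; the
    cells lie between its consecutive quantiles. *)
Lemma uniform_cells (L : nat) : (0 < L)%N -> exists A : 'I_L -> set R,
  [/\ forall v, measurable (A v),
      forall v, D (A v) = (L%:R^-1)%:E,
      forall v x, A v x -> 0 <= x <= 1,
      forall v v' x, A v x -> A v' x -> v = v' &
      forall (v v' : 'I_L) x y, (v' < v)%N -> A v x -> A v' y ->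
        y < x /\ v%:R - v'%:R - 1 <= beta * L%:R * (x - y)].
Proof.
move=> L0; have LR : 0 < L%:R :> R by rewrite ltr0n.
have F_le a b : a <= b -> F a <= F b <= F a + beta * (b - a).
  move=> ab; have : (0 <= D [set` `]a, b]])%E by exact: measure_ge0.
  have := pdf_bounded_itv_le ab.
  by rewrite F_split // !lee_fin => ? ?; apply/andP; split; lra.
have F0 : F 0 = 0.
  have [D1 [f [_ [_ D_f]]]] := D_pdf.
  rewrite /F D_f; last exact: measurable_itv.
  rewrite (_ : `]-oo, 0] `&` `[0, 1] = [set 0] `&` `[0, 1] :> set R).
    by rewrite -D_f ?D1 //; exact: measurable_set1.
  apply/seteqP; split => x /=; rewrite !in_itv /=.
    move=> [x0 /andP[x0' x1]]; rewrite x0' x1; split=> //.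
    by apply/eqP; rewrite eq_le x0.
  by move=> [->]; rewrite lexx.
have F1 : F 1 = 1.
  have [D1 [f [_ [_ D_f]]]] := D_pdf.
  rewrite /F D_f; last exact: measurable_itv.
  rewrite (_ : `]-oo, 1] `&` `[0, 1] = [set: R] `&` `[0, 1] :> set R).
    by rewrite -D_f // probability_setT.
  apply/seteqP; split => x /=; rewrite !in_itv /=; first by move=> [].
  by move=> [_ /andP[-> ->]].
have F_cont : continuous F.
  move=> x; apply/cvgrPdist_le => /= e e0; near=> y.
  have lip a b : `|F a - F b| <= beta * `|a - b|.
    wlog ab : a b / a <= b.
      move=> H; have [/H //|/ltW /H] := leP a b.
      by rewrite distrC [X in _ * X]distrC.
    have /andP[le1 le2] := F_le a b ab.
    rewrite distrC ger0_norm ?subr_ge0 // distrC ger0_norm ?subr_ge0 //.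
    by rewrite lerBlDl.
  apply: le_trans (lip x y) _; rewrite -ler_pdivlMl //.
  near: y; apply: cvgr_dist_le => //.
  by rewrite mulr_gt0 // invr_gt0.
(* Quantiles by the intermediate value theorem; 0 is a placeholder beyond [L]. *)
have /choice[q qP] : forall v : nat, exists q : R, (v <= L)%N ->
    (0 <= q <= 1) /\ F q = v%:R / L%:R.
  move=> v; have [vL|] := leqP v L; last by exists 0.
  have [|q qI Fq] := @IVT R F 0 1 (v%:R / L%:R) ler01 (continuous_subspaceT F_cont).
    rewrite F0 F1 min_l // max_r //.
    by rewrite divr_ge0 //= ler_pdivrMr // mul1r ler_nat.
  by exists q.
have q_mono a b : (a <= L)%N -> (b <= L)%N -> (a <= b)%N -> q a <= q b.
  move=> aL bL; rewrite leq_eqVlt => /predU1P[->//|ab].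
  rewrite leNgt; apply/negP => /ltW /F_le /andP[+ _].
  have [_ ->] := qP _ aL; have [_ ->] := qP _ bL.
  by rewrite ler_pM2r ?invr_gt0 // ler_nat leqNgt ab.
pose A (v : 'I_L) : set R := [set` `]q v, q v.+1]].
have A_lt (v v' : 'I_L) x y : (v' < v)%N -> A v x -> A v' y ->
    y < x /\ v%:R - v'%:R - 1 <= beta * L%:R * (x - y).
  move=> v'v; rewrite /A /= !in_itv /= => /andP[qx _] /andP[_ yq].
  have le_q : q v'.+1 <= q v by apply: q_mono => //; exact: ltnW.
  split; first exact: (le_lt_trans yq (le_lt_trans le_q qx)).
  (* The [v - v' - 1] whole cells between the two points have mass [1 / L] each, which the Lipschitz
     bound turns into distance. *)
  have /F_le /andP[_] := le_q.
  have [_ ->] := qP _ (ltnW (ltn_ord v)); have [_ ->] := qP _ (ltn_ord v').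
  rewrite -lerBlDl -mulrBl ler_pdivrMr // -natr1 => h.
  have : beta * (q v - q v'.+1) * L%:R <= beta * L%:R * (x - y).
    by rewrite mulrAC ler_pM2l ?mulr_gt0 //; lra.
  lra.
exists A; split=> //.
- by move=> v; exact: measurable_itv.
- move=> v; have [vL vL'] : (v <= L)%N /\ (v.+1 <= L)%N by rewrite ltn_ord ltnW.
  rewrite F_split ?q_mono //; have [_ ->] := qP _ vL; have [_ ->] := qP _ vL'.
  by rewrite -mulrBl -natr1 addrAC subrr add0r mul1r.
- move=> v x; rewrite /A /= in_itv /= => /andP[qx xq].
  have [/andP[q0 _] _] := qP v (ltnW (ltn_ord v)).
  have [/andP[_ q1] _] := qP v.+1 (ltn_ord v).
  by rewrite (le_trans q0 (ltW qx)) (le_trans xq q1).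
- move=> v v' x Ax A'x; case: (ltngtP v v') => [lt_v|lt_v|/val_inj //].
    by have [] := A_lt _ _ _ _ lt_v A'x Ax; rewrite ltxx.
  by have [] := A_lt _ _ _ _ lt_v Ax A'x; rewrite ltxx.
Unshelve. all: by end_near. Qed.

End Cells.

(** * Measurability of the fairness event, and passage from counts to probabilities *)

Lemma eq_wps_run (R : realType) (n m : nat) (u u' : 'I_n -> 'I_m -> R) s k :
    (forall i g h, (u i g <= u i h) = (u' i g <= u' i h)) ->
  wps_run u s k = wps_run u' s k.
Proof.
move=> e; elim: k => //= k ->; case: insub => // kk.
case: pickP => // g0 _; congr (rcons _ (_, _)).
congr odflt; apply: eq_pick => g /=; congr andb.
by apply: eq_forallb => h; rewrite e.
Qed.

Section Measurability.
Context (R : realType) (d : measure_display) (Omega : measurableType d).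
Variables (n m : nat) (w : 'I_n -> R) (s : 'I_m -> 'I_n).
Variable U : 'I_n -> 'I_m -> Omega -> R.
Hypothesis mU : forall i g, measurable_fun setT (U i g).

Lemma measurable_finType_forall (T : finType) (B : T -> set Omega) :
  (forall t, measurable (B t)) -> measurable [set om | forall t, B t om].
Proof.
move=> mB; rewrite (_ : mkset _ = \bigcap_(t in [set: T]) B t).
  exact: fin_bigcap_measurable.
by apply/seteqP; split => om /= H; [move=> t _|move=> t]; exact: H.
Qed.

(** There are finitely many patterns of comparisons between utilities, and the allocation is
    constant on each; there the event is given by finitely many inequalities between measurable
    functions. *)
Lemma measurable_WEF : measurable
  [set om | WEF w (fun i g => U i g om) (wps_alloc (fun i g => U i g om) s)].
Proof.
set W := mkset _.
pose le_at (t : 'I_n * 'I_m * 'I_m) om := U t.1.1 t.1.2 om <= U t.1.1 t.2 om.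
pose pattern (c : {ffun 'I_n * 'I_m * 'I_m -> bool}) := [set om | forall t, le_at t om = c t].
have mle (f g : Omega -> R) : measurable_fun setT f -> measurable_fun setT g ->
    measurable [set om | f om <= g om].
  by move=> mf mg; rewrite -[X in measurable X]setTI; exact: measurable_fun_le.
have mpattern c : measurable (pattern c).
  apply: measurable_finType_forall => t; case: (c t).
    by apply: mle; exact: mU.
  rewrite [X in measurable X](_ : _ = ~` [set om | le_at t om]); first by apply: measurableC; apply: mle; exact: mU.
  by apply/seteqP; split => om /=; [move=> -> | move/negP/negbTE].
rewrite (_ : W = \bigcup_(c in [set: {ffun 'I_n * 'I_m * 'I_m -> bool}]) (pattern c `&` W)); last first.
  apply/seteqP; split => [om Wom|om [c _ []]//].
  by exists [ffun t => le_at t om] => //; split=> // t; rewrite ffunE.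
apply: fin_bigcup_measurable => [//|c _].
(* A point [om0] of the pattern, if there is one, supplies its allocation. *)
have [[om0 om0c]|none] := pselect (exists om0, pattern c om0); last first.
  rewrite (_ : _ `&` _ = set0) //; apply/seteqP; split => // om [cc _].
  by apply: none; exists om.
pose A := wps_alloc (fun i g => U i g om0) s.
have -> : pattern c `&` W = pattern c `&` [set om | WEF w (fun i g => U i g om) A].
  have eA om : pattern c om -> wps_alloc (fun i g => U i g om) s = A.
    move=> omc; rewrite /A /wps_alloc; apply/funext => i; apply/setP => g; rewrite !inE.
    rewrite (@eq_wps_run _ _ _ _ (fun i g => U i g om0)) // => i' g' h'.
    by have := omc (i', g', h'); have := om0c (i', g', h'); rewrite /le_at /= => -> ->.
  by apply/seteqP; split => om [omc]; rewrite /W /= eA.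
apply: measurableI => //.
apply: measurable_finType_forall => i; apply: measurable_finType_forall => j.
have mutil k : measurable_fun setT (fun om => util (fun i g => U i g om) i (A k) / w k).
  apply: measurable_funM => //; rewrite /util.
  rewrite [X in measurable_fun _ X](_ : _ =
    fun om => \sum_g if g \in A k then U i g om else 0).
    by apply: measurable_sum => g; case: (g \in A k).
  by apply/funext => om; rewrite big_mkcond.
exact: mle.
Qed.

End Measurability.

(** The matrix of cells is uniform: the events [E v] are disjoint, and independence gives them all
    the same probability. *)
Lemma iid_cells_prob_ge (R : realType) (d : measure_display) (Omega : measurableType d)
    (P : probability Omega R) (D : probability (measurableTypeR R) R) (n m L : nat)
    (U : 'I_n -> 'I_m -> Omega -> R) (A : 'I_L -> set R)
    (good : pred {ffun 'I_n -> {ffun 'I_m -> 'I_L}}) (W : set Omega) :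
    (0 < L)%N -> iid_with P U D ->
    (forall v, measurable (A v)) -> (forall v, D (A v) = (L%:R^-1)%:E) ->
    (forall v v' x, A v x -> A v' x -> v = v') ->
    measurable W ->
    (forall v om, good v -> (forall i g, A (v i g) (U i g om)) -> W om) ->
  ((#|good|%:R / #|{ffun 'I_n -> {ffun 'I_m -> 'I_L}}|%:R)%:E <= P W)%E.
Proof.
move=> L0 [mU [U_D U_indep]] mA DA A_inj mW goodW.
have LR : 0 < L%:R :> R by rewrite ltr0n.
pose E (v : {ffun 'I_n -> {ffun 'I_m -> 'I_L}}) := [set om | forall i g, A (v i g) (U i g om)].
have mUA i g v : measurable (U i g @^-1` A v).
  by rewrite -[X in measurable X]setTI; apply: mU.
have mE v : measurable (E v).
  by do 2![apply: measurable_finType_forall => ?]; exact: mUA.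
have PE v : P (E v) = (#|{ffun 'I_n -> {ffun 'I_m -> 'I_L}}|%:R^-1)%:E.
  have fin : P (E v) \is a fin_num by exact: fin_num_measure.
  rewrite -(fineK fin); congr EFin; rewrite (U_indep (fun i g => A (v i g))) //.
  under eq_bigr do under eq_bigr do rewrite U_D // DA /=.
  by rewrite !prodr_const !card_ord !card_ffun !card_ord !natrX !exprVn.
have Pgood : P (\bigcup_(v in [set` enum good]) E v) =
    (#|good|%:R / #|{ffun 'I_n -> {ffun 'I_m -> 'I_L}}|%:R)%:E.
  rewrite measure_fin_bigcup //=.
  - rewrite -fsbig_seq ?enum_uniq //.
    under eq_bigr do rewrite PE.
    by rewrite big_enum /= sumEFin sumr_const mulr_natl.
  - apply/trivIsetP => v v' _ _; apply: contra_neqP => /eqP/set0P[om [Ev Ev']].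
    by apply/ffunP => i; apply/ffunP => g; exact: A_inj (Ev i g) (Ev' i g).
rewrite -Pgood; apply: le_measure; rewrite ?inE //.
  by apply: fin_bigcup_measurable => //.
move=> om [v /=]; rewrite mem_enum => gv Ev; exact: goodW gv Ev.
Qed.

(** * Growth of [l!] for [l] of order log n / log log n *)

Lemma ffact_le_expn (c l : nat) : (c ^_ l <= c ^ l)%N.
Proof.
elim: l c => [|l IH] c //; rewrite ffactnS expnS leq_mul2l; apply/orP; right.
by apply: leq_trans (IH c.-1) _; case: (l) => // e; rewrite leq_exp2r // leq_pred.
Qed.

Lemma lnln_ge (R : realType) (Y : R) : exists N : nat, forall n : nat, (N <= n)%N ->
  Y <= ln (ln n%:R).
Proof.
exists (Num.trunc (expR (expR Y))).+1 => n Nn.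
have le1 : expR (expR Y) <= n%:R.
  by apply: ltW; apply: lt_le_trans (truncnS_gt _) _; rewrite ler_nat.
have n_gt0 : 0 < n%:R :> R by apply: lt_le_trans (expR_gt0 _) le1.
have le2 : expR Y <= ln n%:R by rewrite -ler_expR lnK.
have ln_gt0 : 0 < ln n%:R :> R by apply: lt_le_trans (expR_gt0 _) le2.
by rewrite -ler_expR [X in _ <= X]lnK.
Qed.

(** The ratio of [l ^ l] to [l!] is a term of the exponential series at [l]. *)
Lemma exprn_le_fact_expR (R : realType) (l : nat) : (0 < l)%N ->
  l%:R ^+ l <= l`!%:R * expR 1 ^+ l :> R.
Proof.
case: l => // l _.
have := @expR_ge1Dxn R l.+1%:R l (ler0n _ _); rewrite -expRM_natl mulr1 => le_exp.
have f_gt0 : 0 < ((l.+1)`!)%:R :> R by rewrite ltr0n fact_gt0.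
by rewrite mulrC -ler_pdivrMr //; lra.
Qed.

(* With [y = ln ln n], [l >= 8 exp y / y] exceeds [B e exp (y / 2)] eventually,
   and then [(l / e) ^ l >= B ^ l exp (l y / 2) >= B ^ l n ^ 4]. *)
Lemma fact_dominates (R : realType) (B : R) : 0 < B ->
  exists N : nat, forall n : nat, (N <= n)%N ->
    let q : R := ln n%:R / ln (ln n%:R) in
    let l := (Num.trunc (8 * q)).+1 in
    1 <= q /\ n%:R ^+ 3 * B ^+ l <= l`!%:R.
Proof.
move=> B_gt0; have e_gt0 : 0 < expR 1 :> R by exact: expR_gt0.
have [N HN] := lnln_ge (Num.max 1 (expR 1 * B)).
exists N => n /HN; rewrite ge_max => /andP[y1 yB] q l.
set y := ln (ln n%:R) in y1 yB q l *.
have y_gt0 : 0 < y by lra.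
have x_gt0 : 0 < ln n%:R :> R.
  by rewrite ltNge; apply/negP => /ln0 e; move: y_gt0; rewrite /y e ltxx.
have xE : ln n%:R = expR y by rewrite /y lnK.
have n_gt0 : 0 < n%:R :> R.
  by rewrite ltNge; apply/negP => /ln0 e; move: x_gt0; rewrite e ltxx.
have q1 : 1 <= q.
  by rewrite /q -/y xE ler_pdivlMr // mul1r; have := expR_ge1Dx y; lra.
split=> //.
have l_ge : 8 * q <= l%:R by apply/ltW/truncnS_gt.
have l_gt0 : (0 < l)%N by [].
clearbody l.
pose h := expR (y / 2).
have h_gt0 : 0 < h by exact: expR_gt0.
have hh : expR y = h * h by rewrite /h -expRD -splitr.
have h_ge : y * y / 8 <= h.
  have := @expR_ge1Dxn R (y / 2) 1 (divr_ge0 (ltW y_gt0) (ler0n _ 2)); rewrite -/h => le_h.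
  apply: le_trans le_h; rewrite expr2 (_ : 2`!%N = 2%N) //; lra.
have l_big : expR 1 * B * h <= l%:R.
  apply: le_trans l_ge; rewrite /q -/y xE hh mulrA ler_pdivlMr //.
  have : y * (y * h) <= 8 * h * h by have := ler_wpM2r (ltW h_gt0) h_ge; lra.
  have : expR 1 * B * (y * h) <= y * (y * h) by rewrite ler_wpM2r // mulr_ge0 // ltW.
  lra.
have l_pow : (expR 1 * B * h) ^+ l <= l%:R ^+ l.
  by rewrite lerXn2r // nnegrE ?mulr_ge0 // ltW.
have hl : n%:R ^+ 3 <= h ^+ l.
  rewrite -{1}[n%:R]lnK // /h -!expRM_natl ler_expR xE.
  have : 8 * q * y <= l%:R * y by rewrite ler_wpM2r // ltW.
  rewrite /q -/y -mulrA divfK ?gt_eqF // xE.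
  by have := expR_gt0 y; lra.
have := le_trans l_pow (exprn_le_fact_expR R l_gt0).
rewrite !exprMn => le_l.
rewrite -(ler_pM2r (exprn_gt0 l e_gt0)); apply: le_trans le_l.
have eB_gt0 : 0 < expR 1 ^+ l * B ^+ l by rewrite mulr_gt0 // exprn_gt0.
have : n%:R ^+ 3 * (expR 1 ^+ l * B ^+ l) <= h ^+ l * (expR 1 ^+ l * B ^+ l).
  by rewrite ler_pM2r.
lra.
Qed.

(** Uses that ['C(c, l)] is at most [c ^ l / l!], and that rounding up and [l <= L] keep the budget
    at most [(beta + 2) * L]. *)
Lemma envy_fraction_le (R : realType) (beta : R) (L l : nat) :
    0 < beta -> (0 < L)%N -> (l <= L)%N ->
  16 ^+ l * 'C((Num.trunc (beta * L%:R + l%:R)).+1, l)%:R / L%:R ^+ l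
  <= (16 * (beta + 2)) ^+ l / l`!%:R.
Proof.
move=> beta_gt0 L_gt0 lL; have LR : 0 < L%:R :> R by rewrite ltr0n.
have l_gt0 : 0 < l`!%:R :> R by rewrite ltr0n fact_gt0.
set c := (Num.trunc _).+1.
have cL : c%:R <= (beta + 2) * L%:R.
  have x_ge0 : 0 <= beta * L%:R + l%:R by rewrite addr_ge0 // mulr_ge0 // ltW.
  have := truncn_le (beta * L%:R + l%:R); rewrite x_ge0 => le_t.
  have : l%:R <= L%:R :> R by rewrite ler_nat.
  have : 1 <= L%:R :> R by rewrite ler1n.
  by rewrite /c -natr1; lra.
rewrite exprMn -[X in _ <= X]mulrA -[X in X <= _]mulrA ler_pM2l ?exprn_gt0 //.
rewrite ler_pdivrMr ?exprn_gt0 // mulrAC ler_pdivlMr // -exprMn.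
apply: (@le_trans _ _ (c%:R ^+ l)); first by rewrite -natrM bin_ffact -natrX ler_nat ffact_le_expn.
by rewrite lerXn2r // nnegrE // mulr_ge0 // ltW //; lra.
Qed.

(** * Choice of the parameters *)

Theorem theorem1 (R : realType) (D : probability (measurableTypeR R) R) (C : R) :
  pdf_bounded D -> 1 <= C ->
  exists K : R, 0 < K /\
  forall eps : R, 0 < eps ->
  exists N : nat, forall n m : nat, (N <= n)%N ->
    K * (n%:R * ln n%:R / ln (ln n%:R)) <= m%:R ->
  forall w : 'I_n -> R, (forall i, 0 < w i) -> (forall i j, w i <= C * w j) ->
  forall s : 'I_m -> 'I_n, valid_wps w s ->
  forall (d : measure_display) (Omega : measurableType d)
         (P : probability Omega R) (U : 'I_n -> 'I_m -> Omega -> R),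
    iid_with P U D ->
    ((1 - eps)%:E <= P [set om | WEF w (fun i g => U i g om)
                                       (wps_alloc (fun i g => U i g om) s)])%E.
Proof.
move=> [alpha [beta [alpha_gt0 [beta_gt0 D_pdf]]]] C1.
(* The first half of the run must exceed [n * (C * l + 1)], which is at most [10 * C * n * q];
   doubling gives 20, and the rest absorbs the rounding of [m / 2]. *)
exists (24 * C); split; first by lra.
move=> eps eps_gt0.
have B_gt0 : 0 < 16 * (beta + 2) by lra.
have [N0 HN0] := fact_dominates B_gt0.
(* Each of the three bad events gets [eps / 3]; for two of them the bound will be [1 / n]. *)
exists (maxn N0 (Num.trunc (3 / eps)).+1) => n m.
rewrite geq_max => /andP[/HN0[]]; rewrite -[n%:R * _ / _]mulrA.
set q := ln n%:R / ln (ln n%:R); set l := (Num.trunc (8 * q)).+1 => q1 fact_l n_big.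
have l_le : l%:R <= 8 * q + 1.
  by rewrite /l -natr1 lerD2r truncn_le mulr_ge0 // (le_trans ler01 q1).
clearbody l.
have n_gt0 : (0 < n)%N by exact: leq_trans n_big.
have nR : 1 <= n%:R :> R by rewrite ler1n.
have n_eps : 1 / n%:R <= eps / 3.
  have : 3 / eps <= n%:R by apply/ltW/(lt_le_trans (truncnS_gt _)); rewrite ler_nat.
  by rewrite !ler_pdivrMr ?ltr0n //; lra.
clear HN0 n_big => m_big w w_gt0 wC.
have nq : n%:R <= n%:R * q by rewrite ler_peMr.
have Cnq : n%:R * q <= C * (n%:R * q) by rewrite ler_peMl // mulr_ge0 //; lra.
have m2n : (2 * n <= m)%N by rewrite -(ler_nat R) natrM; lra.
case: m m_big m2n => [|m'] m_big m2n.
  by move: m2n; rewrite leqNgt muln_gt0 n_gt0.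
move=> s s_valid d Omega P U U_iid.
pose m := m'.+1; pose a := m./2.
have am : (a.*2 <= m)%N by rewrite -[X in (_ <= X)%N]odd_double_half leq_addl.
have am' : (a <= m)%N by apply: leq_trans am; rewrite -addnn leq_addr.
have a_big : n%:R * (C * l%:R + 1) < a%:R.
  have : m%:R <= 2 * a%:R + 1 :> R.
    by rewrite -natrM natr1 ler_nat -{1}[m]odd_double_half mul2n -add1n leq_add2r leq_b1.
  have : n%:R * (C * l%:R + 1) <= n%:R * (10 * (C * q)).
    rewrite ler_wpM2l // ?ler0n //.
    have : C * l%:R <= C * (8 * q + 1) by rewrite ler_wpM2l //; lra.
    have : C * 1 <= C * q by rewrite ler_wpM2l //; lra.
    lra.
  move: m_big; rewrite -/m; lra.
have lt_l j : (l < picks_before s m j)%N.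
  apply: leq_trans (picks_before_mono s j am').
  exact: (picks_before_gt w_gt0 s_valid (C := C)).
(* The first summand makes ties rare, and adding [l] ensures [l <= L]. The number of cells may
   depend on [n], [m] and [eps], since cells occur only in the analysis. *)
pose L' := ((Num.trunc (3 * (n%:R * m%:R ^+ 2) / eps)).+1 + l)%N.
pose L := (16 * L')%N; pose c := (Num.trunc (beta * L%:R + l%:R)).+1.
have L'_gt0 : (0 < L')%N by rewrite /L' addSn.
have L_gt0 : (0 < L)%N by rewrite muln_gt0.
have lL : (l <= L)%N.
  by apply: (@leq_trans L'); rewrite ?leq_addl // leq_pmull.
have L_ge : 3 * (n%:R * m%:R ^+ 2) / eps <= L%:R.
  apply/ltW/(lt_le_trans (truncnS_gt _)); rewrite ler_nat.
  by apply: (@leq_trans L'); rewrite ?leq_addr // leq_pmull.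
have c_big : beta * L%:R + l%:R <= c%:R by apply/ltW/truncnS_gt.
have := envy_fraction_le beta_gt0 L_gt0 lL; rewrite -/c => envy_frac.
clearbody c; rewrite {}/L in L_gt0 lL L_ge c_big envy_frac; clearbody L'.
have L_big : n%:R * m%:R ^+ 2 / (16 * L')%:R <= eps / 3.
  by move: L_ge; rewrite !ler_pdivrMr ?ltr0n //; lra.
have [A [mA DA A01 A_inj A_sep]] := uniform_cells alpha_gt0 beta_gt0 D_pdf L_gt0.
set W := mkset _.
have goodW v om : good l a c s v -> (forall i g, A (v i g) (U i g om)) -> W om.
  move=> /andP[/forallP ok /forallP no_envy] Av.
  apply: (good_matrix_WEF w_gt0 wC s_valid C1 beta_gt0 am' a_big c_big (v := v)).
  - by move=> i g; apply: A01 (Av i g).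
  - by move=> i g h lt_v; apply: A_sep lt_v (Av i h) (Av i g).
  - by move=> i; have /andP[] := ok i.
  - by move=> i; have /andP[] := ok i.
  - by move=> i j; have /forallP := no_envy i; exact.
have := iid_cells_prob_ge L_gt0 U_iid mA DA A_inj (measurable_WEF w s U_iid.1) goodW.
apply: le_trans.
rewrite lee_fin.
have := @card_not_good n m' L' l a c s R L'_gt0 am lt_l.
rewrite -/m; set M := #|{: _}|%:R; set bad := #|_|%:R => bad_le.
have M_gt0 : 0 < M.
  by rewrite ltr0n; apply/card_gt0P; exists [ffun _ => [ffun _ => Ordinal L_gt0]].
have goodE : #|good (L' := L') l a c s|%:R = M - bad :> R.
  by rewrite /M -(cardC (good (L' := L') l a c s)) natrD addrK.
rewrite goodE ler_pdivlMr //.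
(* From [m >= 2 * n] and [n < 2 ^ n]. *)
have small_le : n%:R / 2 ^+ m <= 1 / n%:R :> R.
  rewrite ler_pdivrMr ?exprn_gt0 // mulrAC ler_pdivlMr ?ltr0n // mul1r -natrM -natrX ler_nat.
  apply: (@leq_trans (2 ^ n * 2 ^ n)%N); first by rewrite leq_mul // ltnW // ltn_expl.
  by rewrite -expnD leq_pexp2l // addnn -mul2n.
(* The third power of [n] in [fact_dominates] pays for the [n ^ 2] pairs and leaves [1 / n]. *)
have envy_le : n%:R ^+ 2 * (16 ^+ l * 'C(c, l)%:R / (16 * L')%:R ^+ l) <= 1 / n%:R :> R.
  apply: (@le_trans _ _ (n%:R ^+ 2 * n%:R ^- 3)).
    rewrite ler_wpM2l ?exprn_ge0 //; apply: le_trans envy_frac _.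
    rewrite ler_pdivrMr ?ltr0n ?fact_gt0 // [X in _ <= X]mulrC ler_pdivlMr ?exprn_gt0 ?ltr0n //.
    by rewrite [X in X <= _]mulrC.
  by rewrite [n%:R ^+ 3]exprS invfM mulrCA divff ?mulr1 ?mul1r // expf_neq0 // pnatr_eq0 -lt0n.
have : bad <= eps * M by apply: le_trans bad_le _; rewrite ler_pM2r //; lra.
lra.
Qed.
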